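(* Let $n\geq 1$. For every graph $G$ on $n$ vertices, if the minimum degree satisfies $\delta(G)\geq \frac{2n-5}{3}$, then $\mathrm{tc}_2(G)\leq 2$.
   Context: Graphs are finite and simple. The $r$-color tree-cover number $\mathrm{tc}_r(G)$ is the minimum $s$ such that for every $r$-coloring of the edges of $G$ (an arbitrary assignment of one of $r$ colors to each edge) there exists a collection of monochromatic connected subgraphs $\{H_1,\dots,H_t\}$ with $t\leq s$ such that $V(H_1)\cup\dots\cup V(H_t)=V(G)$. (A single vertex counts as a monochromatic connected subgraph.) *)

(* Defs.v *)
From mathcomp Require Import all_boot all_order all_algebra.
Set Implicit Arguments.
Unset Strict Implicit.
Unset Printing Implicit Defensive.

Record sgraph := SGraph {
  vertex :> finType;
  adj : rel vertex;
  adj_sym : symmetric adj;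
  adj_irr : irreflexive adj
}.

Section GraphDefs.
Variable G : sgraph.

Definition degree (v : G) : nat := #|[set w | adj v w]|.

(* The default value #|G| exceeds every degree, so it only matters when G has
   no vertex. *)
Definition min_degree : nat := \big[Order.min/#|G|]_(v : G) degree v.

Definition edges : {set {set G}} :=
  [set [set x; y] | x in G, y in G & adj x y].

Definition edge : finType := {A : {set G} | A \in edges}.

Definition coloring (r : nat) : finType := {ffun edge -> 'I_r}.

(* A candidate subgraph is a pair (vertex set, edge set). *)
Definition is_subgraph (H : {set G} * {set {set G}}) : bool :=
  (H.2 \subset edges) && [forall A in H.2, A \subset H.1].

Definition is_connected (H : {set G} * {set {set G}}) : bool :=
  (H.1 != set0) &&
  [forall x in H.1, forall y in H.1,
     connect (fun u v : G => [set u; v] \in H.2) x y].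

(* Comparing edges pairwise makes an edgeless H monochromatic, even when
   r = 0. *)
Definition monochromatic r (c : coloring r) (H : {set G} * {set {set G}}) :
    bool :=
  [forall A : edge, forall B : edge,
     (val A \in H.2) && (val B \in H.2) ==> (c A == c B)].

Definition mono_connected_subgraph r (c : coloring r)
    (H : {set G} * {set {set G}}) : bool :=
  [&& is_subgraph H, is_connected H & monochromatic c H].

Definition mono_cover r (c : coloring r)
    (HH : {set {set G} * {set {set G}}}) : bool :=
  [forall H in HH, mono_connected_subgraph c H] &&
  (\bigcup_(H in HH) H.1 == [set: G]).

Definition tree_coverable (r s : nat) : bool :=
  [forall c : coloring r,
     exists HH : {set {set G} * {set {set G}}},
       (#|HH| <= s) && mono_cover c HH].

Lemma ex_tree_coverable r : exists s, tree_coverable r s.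
Proof.
exists #|G|; apply/forallP=> c; apply/existsP.
exists [set ([set x], set0) | x : G]; rewrite leq_imset_card /=.
apply/andP; split.
  apply/forall_inP=> _ /imsetP[x _ ->]; apply/and3P; split.
  - by rewrite /is_subgraph sub0set; apply/forall_inP=> A; rewrite inE.
  - apply/andP; split; first by apply/set0Pn; exists x; rewrite inE.
    by apply/forall_inP=> _ /set1P->; apply/forall_inP=> _ /set1P->.
  - by apply/forallP=> A; apply/forallP=> B; rewrite !inE.
apply/eqP/setP=> x; rewrite inE; apply/bigcupP.
by exists ([set x], set0); [apply: imset_f | rewrite inE].
Qed.

End GraphDefs.

Definition tc (r : nat) (G : sgraph) : nat := ex_minn (ex_tree_coverable G r).

(* Main.v *)
Require Import Defs.
From mathcomp Require Import all_boot all_order all_algebra.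
From mathcomp Require Import zify lra.
Set Implicit Arguments.
Unset Strict Implicit.
Unset Printing Implicit Defensive.
Import Order.TTheory GRing.Theory Num.Theory.
Local Open Scope ring_scope.

(** Send each vertex to the pair (its colour-0 component, its colour-1
    component), that is, to an edge of a bipartite graph on the components.  Two
    components covering V(G) are a vertex cover of size two of that bipartite
    graph, so by König's theorem, if there is none, there are three vertices
    pairwise in different components of both colours.  A vertex w adjacent to
    one of them shares a component with it, and w has only two components, so w
    is adjacent to at most two of the three; the three are moreover pairwise
    nonadjacent.  Hence their degrees sum to at most 2(n - 3), which is too
    small. *)

Definition separated (T : Type) (A : eqType) (f : 'I_2 -> T -> A) (x y : T) :=
  [forall i, f i x != f i y].

Lemma ord2P (i : 'I_2) : i = ord0 \/ i = ord_max.
Proof. by case: i => [[|[|]]] // ?; [left | right]; apply: val_inj. Qed.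

Lemma separatedE (T : Type) (A : eqType) (f : 'I_2 -> T -> A) (x y : T) :
  separated f x y = (f ord0 x != f ord0 y) && (f ord_max x != f ord_max y).
Proof.
apply/forallP/andP => [h|[h0 h1] i]; first by split; apply: h.
by case: (ord2P i) => ->.
Qed.

(* A pair of lines covering both [x] and [y] is one of four; the points [a],
   [d], [p], [q] each escape one of these pairs. *)
Lemma konig_augment (T : Type) (A B : eqType) (r : T -> A) (b : T -> B)
    (sep := fun x y => (r x != r y) && (b x != b y)) (x y a d p q : T) :
  (forall u v w, ~~ [&& sep u v, sep v w & sep u w]) ->
  sep x y -> r a != r x -> r a != r y -> b d != b x -> b d != b y ->
  r p != r x -> b p != b y -> r q != r y -> b q != b x -> False.
Proof.
move=> no3.
(* If [b a] avoids both [b x] and [b y], then [a], [x], [y] are pairwise separated; if it equals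
   [b y], exchange [x] with [y] and [p] with [q]. *)
wlog bax : x y p q / b a = b x.
  move=> wl xy ax ay dx dy px py qy qx.
  have [bax|nbax] := eqVneq (b a) (b x); first exact: (wl x y p q).
  have [bay|nbay] := eqVneq (b a) (b y).
    by apply: (wl y x q p) => //; rewrite /sep eq_sym [b y == _]eq_sym.
  by move: (no3 a x y); rewrite /sep ax ay nbax nbay -/(sep x y) xy.
move=> /andP[rxy bxy] rax ray dx dy px py qy qx.
have rdy : r d = r y.
  apply/eqP; apply: contraT => rdy.
  have [rdx|rdx] := eqVneq (r d) (r x).
    by move: (no3 a d y); rewrite /sep bax rdx rax ray rxy dy bxy eq_sym dx.
  by move: (no3 d x y); rewrite /sep rdx rdy dx dy rxy bxy.
(* Since [a] can stand in for [x] on the line [b x], and [d] for [y] on the line [r y], the pairs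
   [x, y], [a, y], [x, d] and [a, d] are all separated. As [q] avoids both of these lines, it
   extends one of the pairs to a separated triple. *)
have [bqd|bqd] := eqVneq (b q) (b d).
  have [rqx|rqx] := eqVneq (r q) (r x).
    move: (no3 q a y); rewrite /sep bax bqd rqx ray rxy dx dy bxy.
    by rewrite [r x == _]eq_sym rax.
  by move: (no3 q x y); rewrite /sep bqd rqx qy dx dy rxy bxy.
have [rqa|rqa] := eqVneq (r q) (r a).
  move: (no3 q x d); rewrite /sep rdy rqa rax ray qx rxy bqd.
  by rewrite [b x == _]eq_sym dx.
move: (no3 q a d); rewrite /sep rdy bax rqa qx ray qy bqd.
by rewrite [b x == _]eq_sym dx.
Qed.

(** König's theorem for matching number at most two. Given a separated pair, the four choices of one
    line through each of its points are tried; if each misses some point, the missed points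
    contradict [konig_augment]. *)
Lemma konig_two_lines (T : finType) (A : eqType) (f : 'I_2 -> T -> A) (x0 : T) :
  (forall x y z,
     ~~ [&& separated f x y, separated f y z & separated f x z]) ->
  exists i x j y, forall v, (f i v == f i x) || (f j v == f j y).
Proof.
move=> no3.
have [/existsP[x /existsP[y xy]]|nopair] :=
  boolP [exists x, exists y, separated f x y]; last first.
  (* Without a separated pair, every [v] shares a line with [x0]. *)
  exists ord0, x0, ord_max, x0 => v; apply: contraR nopair.
  rewrite negb_or -separatedE => vx.
  by apply/existsP; exists v; apply/existsP; exists x0.
have line i j :
    (exists i x j y, forall v, (f i v == f i x) || (f j v == f j y)) \/
    exists2 v, f i v != f i x & f j v != f j y.
  have [/forallP h|] := boolP [forall v, (f i v == f i x) || (f j v == f j y)].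
    by left; exists i, x, j, y.
  by rewrite negb_forall => /existsP[v]; rewrite negb_or => /andP[]; right; exists v.
case: (line ord0 ord0) => [//|[a ax ay]].
case: (line ord_max ord_max) => [//|[d dx dy]].
case: (line ord0 ord_max) => [//|[p px py]].
case: (line ord_max ord0) => [//|[q qx qy]].
case: (@konig_augment _ _ _ (f ord0) (f ord_max) x y a d p q) => //.
  by move=> u v w; rewrite -!separatedE.
by rewrite -separatedE.
Qed.

Section ColorComponents.
Variables (G : sgraph) (r : nat) (c : coloring G r).

Definition color_adj (i : 'I_r) : rel G :=
  fun u v => [exists e : edge G, (val e == [set u; v]) && (c e == i)].

Lemma color_adj_sym i : symmetric (color_adj i).
Proof. by move=> u v; rewrite /color_adj setUC. Qed.

Lemma color_connect_sym i : connect_sym (color_adj i).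
Proof. exact/sym_connect_sym/color_adj_sym. Qed.

Lemma adj_color_adj u v : adj u v -> exists i, color_adj i u v.
Proof.
move=> uv; have uvE : [set u; v] \in edges G by apply: imset2_f; rewrite ?inE.
pose e : edge G := Sub [set u; v] uvE.
by exists (c e); apply/existsP; exists e; rewrite SubK !eqxx.
Qed.

Definition color_component (i : 'I_r) (x : G) : {set G} * {set {set G}} :=
  let V := [set v | connect (color_adj i) x v] in
  (V, [set val e | e : edge G & (c e == i) && (val e \subset V)]).

(** Testing one end is enough: an edge of colour [i] with one end in the component has both
    there. *)
Lemma color_component_edges i x u v :
  ([set u; v] \in (color_component i x).2) =
  color_adj i u v && connect (color_adj i) x u.
Proof.
apply/imsetP/andP => [[e]|[uv xu]].
  rewrite inE => /andP[ei eV] euv; split.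
    by apply/existsP; exists e; rewrite euv eqxx.
  by have := subsetP eV u; rewrite -euv !inE eqxx => ->.
have /existsP[e /andP[/eqP euv ei]] := uv.
exists e => //; rewrite inE ei euv subUset !sub1set !inE xu.
exact: connect_trans xu (connect1 uv).
Qed.

Lemma color_component_connected i x : is_connected (color_component i x).
Proof.
set H := color_component i x.
pose h : rel G := fun u v => [set u; v] \in H.2.
have h_sym : connect_sym h by apply: sym_connect_sym => u v; rewrite /h setUC.
have h_sub u v : connect h u v -> connect (color_adj i) u v.
  apply: connect_sub => {}u {}v; rewrite /h color_component_edges.
  by case/andP => uv _; apply: connect1.
(* What [x] reaches through edges of [H] alone is closed under colour [i], so it is the whole
   component. *)
have h_closed : closed (color_adj i) (connect h x).
  apply: intro_closed; first exact: color_connect_sym.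
  move=> u v uv xu; apply: (connect_trans xu (connect1 _)).
  by rewrite /h color_component_edges uv; apply: h_sub.
have reach v : v \in H.1 -> connect h x v.
  rewrite inE => /(closed_connect h_closed).
  by rewrite -!topredE /= connect0 => <-.
apply/andP; split; first by apply/set0Pn; exists x; rewrite inE.
apply/forall_inP => u /reach xu; apply/forall_inP => v /reach.
by apply: connect_trans; rewrite h_sym.
Qed.

Lemma color_component_mono i x :
  mono_connected_subgraph c (color_component i x).
Proof.
apply/and3P; split; last 1 first.
- apply/forallP => A; apply/forallP => B; apply/implyP => /andP[].
  case/imsetP => A'; rewrite inE => /andP[/eqP cA _] /val_inj ->.
  by case/imsetP => B'; rewrite inE => /andP[/eqP cB _] /val_inj ->; rewrite cA cB.
- apply/andP; split.
    by apply/subsetP => _ /imsetP[e _ ->]; exact: (valP e).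
  apply/forall_inP => _ /imsetP[e + ->].
  by rewrite inE => /andP[].
- exact: color_component_connected.
Qed.

End ColorComponents.

Lemma degree_sum (G : sgraph) (x : G) : degree x = (\sum_w adj x w)%N.
Proof. by rewrite /degree -sum1dep_card big_mkcond. Qed.

Lemma min_degree_le (G : sgraph) (x : G) : (min_degree G <= degree x)%N.
Proof. by rewrite -leEnat /min_degree (bigminD1 x) // ge_min lexx. Qed.

Lemma separated_degrees (G : sgraph) (A : eqType) (f : 'I_2 -> G -> A)
    (x y z : G) :
  (forall u v, adj u v -> ~~ separated f u v) ->
  separated f x y -> separated f y z -> separated f x z ->
  (degree x + degree y + degree z + 6 <= 2 * #|G|)%N.
Proof.
move=> adjN xy yz xz.
have sepC u v : separated f u v = separated f v u.
  by rewrite !separatedE eq_sym [f ord_max u == _]eq_sym.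
have nadj u v : separated f u v -> adj u v = false.
  by move=> uv; apply: contraTF uv; apply: adjN.
have neq u v : separated f u v -> (u == v) = false.
  by apply: contraTF => /eqP->; rewrite separatedE eqxx.
have sum_pred1 u : (\sum_(w : G) (w == u) = 1)%N.
  by rewrite (bigD1 u) //= eqxx big1 // => w /negPf ->.
(* Spreading 6 as weight 2 on each of [x], [y], [z] reduces the bound to one inequality per vertex
   [w], with right side 2. *)
have -> : (6 = \sum_(w : G) 2 * ((w == x) + (w == y) + (w == z)))%N.
  by rewrite -big_distrr /= !big_split /= !sum_pred1.
rewrite !degree_sum -!big_split /= -sum1_card big_distrr /=.
apply: leq_sum => w _.
have [->|_] := eqVneq w x.
  by rewrite adj_irr !neq // !nadj // sepC.
have [->|_] := eqVneq w y.
  by rewrite adj_irr neq // !nadj // sepC.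
have [->|_] := eqVneq w z.
  by rewrite adj_irr !nadj.
have [/adjN xw|_] := boolP (adj x w); last by case: (adj y w); case: (adj z w).
have [/adjN yw|_] := boolP (adj y w); last by case: (adj z w).
have [/adjN zw|//] := boolP (adj z w).
(* Pigeonhole: two of [x], [y], [z] meet [w] in the same coordinate, hence agree there. *)
move: xw yw zw xy yz xz; rewrite !separatedE !negb_and !negbK.
by do 3![case/orP => /eqP ->]; rewrite ?eqxx ?andbF.
Qed.

Theorem theorem4p6 (n : nat) (n_ge1 : (1 <= n)%N) (G : sgraph)
  (card_G : #|G| = n)
  (min_deg_G : (2 * n%:R - 5) / 3 <= (min_degree G)%:R :> rat) :
  (tc 2 G <= 2)%N.
Proof.
(* The exact negation of the bound in [separated_degrees] once each degree is replaced by the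
   minimum. *)
have deg3 : (2 * n < 3 * min_degree G + 6)%N.
  have : (2 * n%:R < 3 * (min_degree G)%:R + 6 :> rat) by lra.
  by rewrite -!natrM -natrD ltr_nat.
rewrite /tc; case: ex_minnP => s _; apply.
apply/forallP => c.
(* The canonical root serves as the name of a component. *)
pose f i := fingraph.root (color_adj c i).
have adjN u v : adj u v -> ~~ separated f u v.
  case/(adj_color_adj c) => i uv; rewrite negb_forall; apply/existsP; exists i.
  by rewrite negbK root_connect ?connect1 //; apply: color_connect_sym.
have /card_gt0P[x0 _] : (0 < #|G|)%N by rewrite card_G.
have [x y z|i [x [j [y cover]]]] := @konig_two_lines _ _ f x0.
  apply/negP => /and3P[xy yz xz].
  have := separated_degrees adjN xy yz xz; rewrite card_G.
  have := min_degree_le x; have := min_degree_le y; have := min_degree_le z.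
  lia.
apply/existsP.
exists [set color_component c i x; color_component c j y].
rewrite cards2 ltnS leq_b1 /=; apply/andP; split.
  by apply/forall_inP => _ /set2P[] ->; apply: color_component_mono.
apply/eqP/setP => v; rewrite inE; apply/bigcupP.
have sameP k u : f k v == f k u -> v \in (color_component c k u).1.
  by rewrite root_connect ?inE 1?color_connect_sym //; apply: color_connect_sym.
case/orP: (cover v) => /sameP vin.
  by exists (color_component c i x); rewrite ?set21.
by exists (color_component c j y); rewrite ?set22.
Qed.
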